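(* Let $B$ be a based space and $n\ge 1$ (any $n\ge0$). Then there is a homotopy $(\mathbf{Mon},\dots,\mathbf{Mon})$-algebra ($n$ copies) $(X,\xi)$ in $(\mathbf{Top},\times,1)$ with $X(1,\dots,1)=\mathbf{Top}_*(S^n,B)$; that is, every $n$-fold loop space is an $n$-fold homotopy monoid.
   Context: $\mathbf{Top}$: compactly generated Hausdorff spaces, cartesian product $\times$, point $1$, homotopy equivalences as equivalences. $\mathbf{Top}_*(S^n,B)$ is the space of based maps from the $n$-sphere to $B$. $\Delta$: objects $k=\{0,\dots,k-1\}$ ($k\ge0$), order-preserving maps, monoidal under ordinal sum $+$ with unit $0$. A homotopy $(\mathbf{Mon},\dots,\mathbf{Mon})$-algebra in $\mathbf{Top}$ is a colax multi-monoidal functor $(X,\xi):\Delta^n\to(\mathbf{Top},\times,1)$ in which all components of $\xi$ are homotopy equivalences. Here a colax multi-monoidal functor consists of a functor $X:\Delta^n\to\mathbf{Top}$ together with, for each $i\in\{1,\dots,n\}$ and all values of the other variables, maps $X(\dots,0,\dots)\to 1$ and $X(\dots,L_i+L_i',\dots)\to X(\dots,L_i,\dots)\times X(\dots,L_i',\dots)$ (in the $i$th variable), natural in all variables, such that for fixed values of the other variables these make $X$ a colax monoidal functor in the $i$th variable (coassociativity and counit axioms, maps not necessarily invertible), and such that for $i<j$ the structure maps in variables $i$ and $j$ commute: splitting $X(L_i+L_i',L_j+L_j')$ first in variable $i$ then $j$ agrees, after the canonical middle-four interchange, with splitting first in $j$ then $i$; splitting in $i$ then applying the counit in $j$ agrees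 with the counit in $j$ followed by $1\cong1\times1$ (and symmetrically); and the two counit maps $X(0,0)\to1$ (in variables $i$ and $j$) agree (other variables suppressed). *)

(* Defs.v *)
From HB Require Import structures.
From mathcomp Require Import all_boot all_order all_algebra.
From mathcomp Require Import all_classical all_reals all_analysis.
Set Implicit Arguments.
Unset Strict Implicit.
Unset Printing Implicit Defensive.
Import Order.TTheory GRing.Theory Num.Theory.
Import numFieldNormedType.Exports.
Local Open Scope classical_set_scope.
Local Open Scope ring_scope.

Definition kopen (T : topologicalType) (A : set T) :=
  forall K : set T, compact K -> exists U : set T, open U /\ A `&` K = U `&` K.

Definition kspace (T : topologicalType) := forall A : set T, kopen A -> open A.

(* Objects of Top: compactly generated Hausdorff spaces. *)
Definition CGH (T : topologicalType) := hausdorff_space T /\ kspace T.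

Section Kification.
Variable T : topologicalType.

Definition kify : Type := T.
HB.instance Definition _ := Choice.on kify.

Local Lemma kopT : @kopen T setT.
Proof. by move=> K _; exists setT; split => //; exact: openT. Qed.

Local Lemma kopI : setI_closed (@kopen T).
Proof.
move=> A B kA kB K cK.
have [U [oU eU]] := kA K cK; have [V [oV eV]] := kB K cK.
exists (U `&` V); split; first exact: openI.
apply/seteqP; split => x [[Ax Bx] Kx].
- have : (A `&` K) x by []. rewrite eU => -[Ux _].
  have : (B `&` K) x by []. rewrite eV => -[Vx _].
  by [].
- have : (U `&` K) x by []. rewrite -eU => -[Ax' _].
  have : (V `&` K) x by []. rewrite -eV => -[Bx' _].
  by [].
Qed.

Local Lemma kop_bigU (I : Type) (f : I -> set T) :
  (forall i, @kopen T (f i)) -> @kopen T (\bigcup_i f i).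
Proof.
move=> kf K cK.
exists (\bigcup_(p in [set p : I * set T | open p.2 /\ f p.1 `&` K = p.2 `&` K]) p.2).
split; first by apply: bigcup_open => -[i U] [].
apply/seteqP; split.
- move=> x [[i _ fx] Kx]; have [U [oU eU]] := kf i K cK.
  have : (f i `&` K) x by [].
  rewrite eU => -[Ux _]; split => //; by exists (i, U).
- move=> x [[[i U] [oU eU] Ux] Kx].
  have : (U `&` K) x by [].
  rewrite -eU => -[fx _]; split => //; by exists i.
Qed.

HB.instance Definition _ := isOpenTopological.Build kify kopT kopI kop_bigU.
End Kification.

(* The one-point space 1 (its topology is the only one on a point). *)
Definition one_space (R : realType) : topologicalType :=
  (@initial_topology unit R (fun _ => 0) : topologicalType).

(* Homotopies are parametrised by the unit interval [0,1] of R; a homotopy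
   X x [0,1] -> X is a map X * R -> X continuous on X `*` [0,1]. *)
Definition homotopy_equivalence (R : realType) (X Y : topologicalType)
    (f : X -> Y) : Prop :=
  continuous f /\
  exists g : Y -> X, continuous g /\
    (exists H : X * R -> X,
        {within [set: X] `*` `[0, 1], continuous H} /\
        forall x, H (x, 0) = g (f x) /\ H (x, 1) = x) /\
    (exists H : Y * R -> Y,
        {within [set: Y] `*` `[0, 1], continuous H} /\
        forall y, H (y, 0) = f (g y) /\ H (y, 1) = y).

(* The object k of Delta is the ordinal {0,...,k-1} = 'I_k.                  *)

Definition dobj (n : nat) := 'I_n -> nat.

Definition dhom (n : nat) (P Q : dobj n) :=
  forall k : 'I_n, {f : 'I_(P k) -> 'I_(Q k) | {homo f : x y / (x <= y)%N}}.

Definition dhomf n (P Q : dobj n) (h : dhom P Q) (k : 'I_n) :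
  'I_(P k) -> 'I_(Q k) := proj1_sig (h k).
Arguments dhomf {n P Q} h k.

Lemma id_homo (m : nat) : {homo (@id 'I_m) : x y / (x <= y)%N}.
Proof. by []. Qed.

Definition did n (P : dobj n) : dhom P P :=
  fun k => exist _ id (@id_homo (P k)).

Lemma comp_homo a b c (f : 'I_a -> 'I_b) (g : 'I_b -> 'I_c) :
  {homo f : x y / (x <= y)%N} -> {homo g : x y / (x <= y)%N} ->
  {homo (g \o f) : x y / (x <= y)%N}.
Proof. by move=> hf hg x y /hf /hg. Qed.

Definition dcomp n (P Q S : dobj n) (g : dhom Q S) (f : dhom P Q) : dhom P S :=
  fun k => exist _ (dhomf g k \o dhomf f k)
    (comp_homo (proj2_sig (f k)) (proj2_sig (g k))).

(* The underlying function nat -> nat of a map 'I_a -> 'I_b (0 off 'I_a). *)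
Definition ordfun (a b : nat) (f : 'I_a -> 'I_b) (m : nat) : nat :=
  oapp (fun x : 'I_a => nat_of_ord (f x)) 0%N (insub m).

Definition splits n (i : 'I_n) (P Q R : dobj n) : Prop :=
  P i = (Q i + R i)%N /\ forall k, k != i -> Q k = P k /\ R k = P k.

Definition is_sum_hom n (i : 'I_n) (P Q R P' Q' R' : dobj n)
    (h : dhom P P') (f : dhom Q Q') (g : dhom R R') : Prop :=
  (forall k, k != i ->
     ordfun (dhomf h k) =1 ordfun (dhomf f k) /\
     ordfun (dhomf h k) =1 ordfun (dhomf g k)) /\
  (forall m, (m < Q i)%N -> ordfun (dhomf h i) m = ordfun (dhomf f i) m) /\
  (forall m, (m < R i)%N ->
     ordfun (dhomf h i) (Q i + m) = (Q' i + ordfun (dhomf g i) m)%N).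

(* X : Delta^n -> Top with action Xmap on morphisms; xi i P Q R is the       *)
(* colax structure map X(P) -> X(Q) x X(R) in variable i (used only when    *)
(* splits i P Q R), landing in the CGH product k(X(Q) x X(R)).  The counit  *)
(* X(...,0,...) -> 1 is the unique map to the point.                        *)

Definition homotopy_mon_algebra (R : realType) (n : nat)
    (X : dobj n -> topologicalType)
    (Xmap : forall P Q : dobj n, dhom P Q -> X P -> X Q)
    (xi : forall (i : 'I_n) (P Q S : dobj n), X P -> kify (X Q * X S)%type) :
    Prop :=
  [/\
      (forall P, CGH (X P)),
      (forall P Q (h : dhom P Q), continuous (Xmap P Q h)) /\
      (forall P (x : X P), Xmap P P (did P) x = x) /\
      (forall P Q S (f : dhom P Q) (g : dhom Q S) (x : X P),
          Xmap P S (dcomp g f) x = Xmap Q S g (Xmap P Q f x)),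
      (forall i P Q S, splits i P Q S -> continuous (xi i P Q S)) /\
      (forall i P Q S P' Q' S' (h : dhom P P') (f : dhom Q Q') (g : dhom S S'),
          splits i P Q S -> splits i P' Q' S' -> is_sum_hom i h f g ->
          forall x : X P,
            xi i P' Q' S' (Xmap P P' h x) =
            (Xmap Q Q' f (xi i P Q S x).1, Xmap S S' g (xi i P Q S x).2)),
      (forall i P A B C AB BC,
          splits i P AB C -> splits i AB A B ->
          splits i P A BC -> splits i BC B C ->
          forall x : X P,
            let u := xi i P AB C x in let v := xi i AB A B u.1 in
            let u' := xi i P A BC x in let v' := xi i BC B C u'.2 in
            [/\ v.1 = u'.1, v.2 = v'.1 & u.2 = v'.2]) /\
      (forall i P Z, splits i P Z P -> Z i = 0%N ->
          forall x : X P, (xi i P Z P x).2 = x) /\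
      (forall i P Z, splits i P P Z -> Z i = 0%N ->
          forall x : X P, (xi i P P Z x).1 = x) /\
      (forall (i j : 'I_n), (i < j)%N ->
        forall P Q S Q1 Q2 S1 S2 U V,
          splits i P Q S -> splits j Q Q1 Q2 -> splits j S S1 S2 ->
          splits j P U V -> splits i U Q1 S1 -> splits i V Q2 S2 ->
          forall x : X P,
            let a := xi i P Q S x in let b := xi j P U V x in
            xi j Q Q1 Q2 a.1 = ((xi i U Q1 S1 b.1).1, (xi i V Q2 S2 b.2).1) /\
            xi j S S1 S2 a.2 = ((xi i U Q1 S1 b.1).2, (xi i V Q2 S2 b.2).2))
    &
      (forall i P Q S, splits i P Q S ->
          homotopy_equivalence R (xi i P Q S)) /\
      (forall (i : 'I_n) P, P i = 0%N ->
          homotopy_equivalence R (fun _ : X P => (tt : one_space R)))].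

Definition sphere_pred (R : realType) (n : nat) (x : 'rV[R]_n.+1) : bool :=
  \sum_(i < n.+1) x ord0 i ^+ 2 == 1.

Definition sphere (R : realType) (n : nat) : topologicalType :=
  (@initial_topology {x : 'rV[R]_n.+1 | sphere_pred x} 'rV[R]_n.+1
    (fun x => proj1_sig x) : topologicalType).

Definition sphere_base (R : realType) (n : nat) : 'rV[R]_n.+1 :=
  \row_(j < n.+1) (j == ord0)%:R.

Definition based_maps_type (R : realType) (n : nat) (B : topologicalType)
    (b0 : B) : Type :=
  {f : sphere R n -> B |
     continuous f /\ forall s : sphere R n, proj1_sig s = sphere_base R n -> f s = b0}.

Section BasedMaps.
Variables (R : realType) (n : nat) (B : topologicalType) (b0 : B).
HB.instance Definition _ := gen_eqMixin (based_maps_type R n b0).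
HB.instance Definition _ := gen_choiceMixin (based_maps_type R n b0).
End BasedMaps.

(* Subspace of the compact-open topology, then k-ified: this is the
   mapping space Top_*(S^n, B) in compactly generated Hausdorff spaces. *)
Definition based_maps_co (R : realType) (n : nat) (B : topologicalType)
    (b0 : B) : topologicalType :=
  (@initial_topology (based_maps_type R n b0) {compact-open, sphere R n -> B}
    (fun f => proj1_sig f) : topologicalType).

Definition based_map_space (R : realType) (n : nat) (B : topologicalType)
    (b0 : B) : topologicalType := kify (based_maps_co R n b0).

Definition homeomorphic (X Y : topologicalType) : Prop :=
  exists f : X -> Y, exists g : Y -> X,
    [/\ continuous f, continuous g, cancel f g & cancel g f].

(* Main.v *)
(* X(k_1, ..., k_n) is the space of maps from the product of the simplices of
   dimensions k_1, ..., k_n to B sending a point to b0 as soon as one of its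
   components is a vertex.  Its structure maps are restrictions along simplicial
   maps, the colax ones along the inclusions of the front and the back face, so
   the algebra axioms hold strictly.  The colax maps are homotopy equivalences
   because the (q+s)-simplex retracts onto the union of its front q-face and its
   back s-face; as the simplex is convex, the straight line from this retraction
   to the identity is a homotopy, and it fixes the vertices.  Finally
   X(1, ..., 1) is Top_*(S^n, B) since the cube modulo its boundary is S^n. *)
Require Import Defs.
From HB Require Import structures.
From mathcomp Require Import all_boot all_order all_algebra.
From mathcomp Require Import all_classical all_reals all_analysis.
From mathcomp Require Import zify.
From mathcomp Require Import ring lra.
Set Implicit Arguments.
Unset Strict Implicit.
Unset Printing Implicit Defensive.
Import Order.TTheory GRing.Theory Num.Theory.
Import numFieldNormedType.Exports.
Local Open Scope classical_set_scope.
Local Open Scope ring_scope.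

(** * Compactly generated spaces *)

(** A map [k -> l] of Delta pulls a chain [t_1 <= ... <= t_l] back to a chain of length [k]. It thus
    goes from the [l]-simplex to the [k]-simplex, restriction of maps to [B] is covariant on Delta,
    and the algebraic axioms reduce to equalities of index functions. The retraction is the identity
    on both faces, so splitting a joined pair returns that pair exactly, and only the other
    composite calls for a homotopy. The obstacle is topological: mapping spaces and products carry
    k-ified topologies, whereas a homotopy must be continuous for the ordinary product with the
    interval. Whitehead's theorem on products with a locally compact factor bridges the two. In the
    comparison with the sphere, continuity of an inverse is never checked: the cube is compact, so
    the collapsing map is closed. *)

Lemma open_kifyE (T : topologicalType) (A : set T) :
  open (A : set (kify T)) <-> kopen A.
Proof. by []. Qed.

(** On [K] a k-open set coincides with an open set of [T], so a cluster point for [T] is also one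
    for the finer topology. The compact test sets of [T] therefore remain test sets in [kify T],
    which makes k-ification idempotent. *)
Lemma compact_kify (T : topologicalType) (K : set T) :
  compact K -> compact (K : set (kify T)).
Proof.
move=> cK F PF FK; have [p [Kp clp]] := @cK F PF FK.
exists p; split => // A N FA; rewrite nbhsE; case=> O [kO Op] ON.
have [U [oU eU]] := (@open_kifyE T O).1 kO K cK.
have Up : U p by have : (O `&` K) p by []; rewrite eU => -[].
have [q [[Aq Kq] Uq]] :=
  clp _ _ (filterI FA FK) (open_nbhs_nbhs (conj oU Up)).
exists q; split => //; apply: ON.
by have : (U `&` K) q by []; rewrite -eU => -[].
Qed.

Lemma kspace_kify (T : topologicalType) : kspace (kify T).
Proof.
move=> A kA; apply/(@open_kifyE T) => K cK; have [U [kU eU]] := kA K (compact_kify cK).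
have [V [oV eV]] := (@open_kifyE T U).1 kU K cK; by exists V; rewrite eU.
Qed.

Lemma open_kify (T : topologicalType) (A : set T) :
  open A -> open (A : set (kify T)).
Proof. by move=> oA; apply/(@open_kifyE T) => K _; exists A. Qed.

Lemma kify_id_continuous (T : topologicalType) :
  continuous (fun x : kify T => x : T).
Proof. by apply/continuousP => A /open_kify. Qed.

Lemma CGH_kify (T : topologicalType) : hausdorff_space T -> CGH (kify T).
Proof.
move=> hT; split; last exact: kspace_kify.
move=> p q pq; apply: hT => A N nA nN.
by apply: pq; exact: kify_id_continuous.
Qed.

Lemma kify_continuous (S T : topologicalType) (f : S -> T) :
  continuous f -> continuous (f : kify S -> kify T).
Proof.
move=> cf; apply/continuousP => A kA; apply/(@open_kifyE S) => K cK.
have [|U [oU eU]] := (@open_kifyE T A).1 kA (f @` K).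
  by apply: continuous_compact => //; exact: continuous_subspaceT.
exists (f @^-1` U); split; first by move/continuousP : cf; exact.
apply/seteqP; split => x [fx Kx]; split => //.
- have : (A `&` f @` K) (f x) by split => //; exists x.
  by rewrite eU => -[].
- have : (U `&` f @` K) (f x) by split => //; exists x.
  by rewrite -eU => -[].
Qed.

(** Universal property of the coreflection onto k-spaces: the compact sets that test openness in [S]
    have compact images in [T]. *)
Lemma kspace_continuous (S T : topologicalType) (f : S -> T) :
  kspace S -> continuous f -> continuous (f : S -> kify T).
Proof.
move=> kS cf; apply/continuousP => A oA; apply: kS => K cK.
have [U [oU eU]] : exists U : set S, open U /\ f @^-1` A `&` K = U `&` K.
  have /continuousP/(_ _ oA) := kify_continuous cf.
  by move/(@open_kifyE S)/(_ K cK).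
by exists U.
Qed.

Definition has_compact_nbhs (Y : topologicalType) :=
  forall (y : Y) U, nbhs y U -> exists C, [/\ compact C, nbhs y C & C `<=` U].

Lemma has_compact_nbhs_real (R : realType) : has_compact_nbhs R.
Proof.
move=> y U /nbhs_ballP[e /= e0 yeU].
exists `[y - e / 2, y + e / 2]%classic; split; first exact: segment_compact.
- apply/nbhs_ballP; exists (e / 2) => /=; first by rewrite divr_gt0.
  move=> z /=; rewrite /ball /= ltr_norml in_itv /= => /andP[? ?].
  by apply/andP; split; lra.
- move=> z /=; rewrite in_itv /= => /andP[? ?]; apply: yeU => /=.
  by rewrite /ball /= ltr_norml; apply/andP; split; lra.
Qed.

(** The tube lemma: a compact factor can be quantified away. *)
Lemma open_tube (X Y : topologicalType) (U : set (X * Y)) (C : set Y) :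
  open U -> compact C -> open [set x | forall y, C y -> U (x, y)].
Proof.
move=> oU /compact_near_coveringP cC; rewrite openE => x Ux.
apply: (cC X (nbhs x) (fun x' y => U (x', y))) => y Cy.
have /= [[P Q] [/= xP yQ] PQ] := open_nbhs_nbhs (conj oU (Ux y Cy)).
by exists (Q, P) => // -[y' x'] /= [? ?]; apply: PQ.
Qed.

(* Whitehead: a product of a k-space with a locally compact space needs no
   k-ification. *)
Lemma kspace_setX (X Y : topologicalType) :
  kspace X -> has_compact_nbhs Y -> kspace (X * Y)%type.
Proof.
move=> kX lY W kW; rewrite openE => -[x0 y0] W0.
have [C0 [cC0 nC0 _]] := lY y0 setT filterT.
(* Testing on the single slice over [x0] provides [C], a compact neighbourhood of [y0] whose slice
   over [x0] lies in [W]. *)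
have [U [oU eU]] := kW _ (compact_setX (@compact_set1 _ x0) cC0).
have U0 : U (x0, y0).
  have : (W `&` ([set x0] `*` C0)) (x0, y0).
    by split => //; split => //; exact: nbhs_singleton.
  by rewrite eU => -[].
have [[P Q] /= [xP yQ] PQU] := open_nbhs_nbhs (conj oU U0).
have [C [cC nC CQ]] := lY y0 (C0 `&` Q) (filterI nC0 yQ).
exists ([set x | forall y, C y -> W (x, y)], C) => /=; last first.
  by move=> [x y] [/= Wx Cy]; exact: Wx.
split => //; apply: open_nbhs_nbhs; split; last first.
  move=> y /CQ[C0y Qy].
  have : (U `&` ([set x0] `*` C0)) (x0, y).
    split; last by split.
    by apply: PQU; split => //; exact: nbhs_singleton.
  by rewrite -eU => -[].
(* The points whose whole slice over [C] is in [W] form an open set: for compact [K], test [W] on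
   the product of [K] and [C], then apply the tube lemma. *)
apply: kX => K cK; have [V [oV eV]] := kW _ (compact_setX cK cC).
exists [set x | forall y, C y -> V (x, y)]; split; first exact: open_tube.
apply/seteqP; split => x [/= Wx Kx]; split => // y Cy.
- have : (W `&` (K `*` C)) (x, y) by split => //; exact: Wx.
  by rewrite eV => -[].
- have : (V `&` (K `*` C)) (x, y) by split => //; exact: Wx.
  by rewrite -eV => -[].
Qed.

(** * Spaces of maps relative to a subset *)

Definition rel_maps_type (D B : topologicalType) (Z : set D) (b0 : B) : Type :=
  {f : D -> B | continuous f /\ forall z, Z z -> f z = b0}.

HB.instance Definition _ (D B : topologicalType) (Z : set D) (b0 : B) :=
  gen_eqMixin (rel_maps_type Z b0).
HB.instance Definition _ (D B : topologicalType) (Z : set D) (b0 : B) :=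
  gen_choiceMixin (rel_maps_type Z b0).

Definition rel_maps_co (D B : topologicalType) (Z : set D) (b0 : B) :
    topologicalType :=
  (@initial_topology (rel_maps_type Z b0) {compact-open, D -> B}
    (fun f => proj1_sig f) : topologicalType).

(** Same construction as [based_map_space], so that the latter is an instance by conversion
    ([based_map_spaceE]). *)
Definition rel_maps (D B : topologicalType) (Z : set D) (b0 : B) :
  topologicalType := kify (rel_maps_co Z b0).

Lemma open_preimage (S T : topologicalType) (f : S -> T) (O : set T) :
  continuous f -> open O -> open (f @^-1` O).
Proof. by move/continuousP; exact. Qed.

Section InitialCompactOpen.
Variables (W D B : topologicalType) (V : choiceType) (p : V -> D -> B).

Lemma continuous_compact_open
    (F : W -> @initial_topology V {compact-open, D -> B} p) :
  (forall w0 (K : set D) (O : set B), compact K -> open O ->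
     (forall d, K d -> O (p (F w0) d)) ->
     \forall w \near w0, forall d, K d -> O (p (F w) d)) ->
  continuous F.
Proof.
move=> cF; apply: continuous_comp_initial => w0.
apply/compact_open_cvgP => K O cK oO KO.
have := cF w0 K O cK oO.
have h d : K d -> O (p (F w0) d) by move=> Kd; apply: KO; exists d.
move=> /(_ h); apply: filterS => w Kw _ [d Kd <-]; exact: Kw.
Qed.

Lemma open_initial_compact_open (K : set D) (O : set B) :
  compact K -> open O ->
  open ([set f | forall d, K d -> O (p f d)] :
          set (@initial_topology V {compact-open, D -> B} p)).
Proof.
move=> cK oO.
rewrite (_ : [set _ | _] = p @^-1` [set g | g @` K `<=` O]); last first.
  apply/seteqP; split => f /= fK; first by move=> _ [d Kd <-]; exact: fK.
  by move=> d Kd; apply: fK; exists d.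
by exists [set g | g @` K `<=` O] => //; exact: compact_open_open.
Qed.

Lemma hausdorff_initial_compact_open : injective p -> hausdorff_space B ->
  hausdorff_space (@initial_topology V {compact-open, D -> B} p).
Proof.
move=> ip; rewrite !open_hausdorff => hB f g /eqP fg.
have [d /eqP fgd] : exists d, p f d <> p g d.
  by apply/not_existsP => fgd; apply/fg/ip/funext => d; apply: contrapT; exact: fgd.
have [[/= P Q] [Pf Qg] [oP oQ PQ]] := hB _ _ fgd.
(* Singletons are compact, so separating the values at one point [d] suffices. *)
exists ([set f | forall e, [set d] e -> P (p f e)],
        [set f | forall e, [set d] e -> Q (p f e)]) => /=.
  by rewrite !inE in Pf Qg *; split => ? ->.
split; [exact/open_initial_compact_open/oP/compact_set1
       |exact/open_initial_compact_open/oQ/compact_set1|].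
apply/eqP/seteqP; split => // h [/= /(_ _ erefl) Ph /(_ _ erefl) Qh].
by have : (P `&` Q) (p h d) by []; rewrite (eqP PQ).
Qed.

End InitialCompactOpen.

Lemma rel_maps_eq (D B : topologicalType) (Z : set D) (b0 : B)
  (f g : rel_maps Z b0) : proj1_sig f =1 proj1_sig g -> f = g.
Proof. by case: f g => f pf [g pg] /= /funext fg; exact: eq_exist. Qed.

Lemma CGH_rel_maps (D B : topologicalType) (Z : set D) (b0 : B) :
  hausdorff_space B -> CGH (rel_maps Z b0).
Proof.
move=> hB; apply: CGH_kify; apply: hausdorff_initial_compact_open => //.
by move=> f g fg; apply: rel_maps_eq => d; rewrite fg.
Qed.

Section Precomposition.
Variables (D E B : topologicalType) (ZD : set D) (ZE : set E) (b0 : B).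
Variable h : E -> D.
Hypotheses (ch : continuous h) (hZ : forall e, ZE e -> ZD (h e)).

Lemma precomp_subproof (f : rel_maps ZD b0) :
  continuous (proj1_sig f \o h) /\ forall e, ZE e -> (proj1_sig f \o h) e = b0.
Proof.
case: f => f [/= cf fZ]; split; last by move=> e /hZ /fZ.
by move=> e; apply: continuous_comp; [exact: ch | exact: cf].
Qed.

Definition precomp (f : rel_maps ZD b0) : rel_maps ZE b0 :=
  exist _ (proj1_sig f \o h) (precomp_subproof f).

Lemma precomp_continuous : continuous precomp.
Proof.
apply: (@kify_continuous (rel_maps_co ZD b0) (rel_maps_co ZE b0)).
apply: continuous_compact_open => f K O cK oO fKO.
apply: open_nbhs_nbhs; split => //.
have := @open_initial_compact_open D B (rel_maps_type ZD b0)
  (fun f => proj1_sig f) (h @` K) O.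
rewrite (_ : [set _ | _] =
  [set g : rel_maps_co ZD b0 | forall d, K d -> O (proj1_sig (precomp g) d)]).
  by apply => //; apply: continuous_compact => //; exact: continuous_subspaceT.
apply/seteqP; split => g /= gK; first by move=> d Kd; apply: gK; exists d.
by move=> _ [d Kd <-]; exact: gK.
Qed.

End Precomposition.

Section Homotopy.
Variables (D E Y B : topologicalType) (ZD : set D) (ZE : set E) (b0 : B).
Variable h : E * Y -> D.
Hypotheses (ch : continuous h) (hZ : forall e y, ZE e -> ZD (h (e, y))).
Hypotheses (lY : has_compact_nbhs Y).

Lemma precomp_slice_continuous y : continuous (fun e => h (e, y)).
Proof.
move=> e; apply: (@continuous_comp _ _ _ (fun e => (e, y)) h); last exact: ch.
by apply: cvg_pair; [exact: cvg_id | exact: cvg_cst].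
Qed.

Definition precomp_homotopy (w : (rel_maps ZD b0 * Y)%type) : rel_maps ZE b0 :=
  precomp (@precomp_slice_continuous w.2) (hZ^~ w.2) w.1.

(** The source is a k-space, so the k-ification of the target may be dropped. A compact
    neighbourhood [C] of [y] then turns the condition on [K] into one on the compact image under [h]
    of the product of [K] and [C]. *)
Lemma precomp_homotopy_continuous : continuous precomp_homotopy.
Proof.
have kW : kspace (rel_maps ZD b0 * Y)%type.
  by apply: kspace_setX => //; exact: kspace_kify.
apply: (@kspace_continuous _ (rel_maps_co ZE b0)) => //.
apply: continuous_compact_open => -[f y] K O cK oO fKO.
have cf : continuous (proj1_sig f) by case: (proj2_sig f).
have oU : open [set y' | forall e, K e -> O (proj1_sig f (h (e, y')))].
  apply: (@open_tube _ _ [set p | O (proj1_sig f (h (p.2, p.1)))]) => //.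
  apply: (@open_preimage _ _ (fun p => proj1_sig f (h (p.2, p.1)))) => //.
  move=> p; apply: continuous_comp; last exact: cf.
  apply: continuous_comp; last exact: ch.
  by apply: cvg_pair; [exact: cvg_snd | exact: cvg_fst].
have [C [cC nC CU]] := lY (open_nbhs_nbhs (conj oU fKO)).
exists ([set g : rel_maps ZD b0 |
          forall d, (h @` (K `*` C)) d -> O (proj1_sig g d)], C) => /=.
  split => //; apply: open_nbhs_nbhs; split; last first.
    by move=> _ [[e y'] [/= Ke Cy] <-]; exact: CU.
  apply/open_kify/open_initial_compact_open => //.
  by apply: continuous_compact;
    [exact: continuous_subspaceT | exact: compact_setX].
by move=> [g y'] [/= gK Cy] e Ke; apply: gK; exists (e, y').
Qed.

End Homotopy.

Section Glue.
Variables (D E1 E2 B : topologicalType).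
Variables (Z : set D) (Z1 : set E1) (Z2 : set E2) (b0 : B).
Variables (F1 F2 : set D) (r1 : D -> E1) (r2 : D -> E2).
Hypotheses (cr1 : continuous r1) (cr2 : continuous r2).
Hypotheses (clF1 : closed F1) (clF2 : closed F2) (F12 : forall d, F1 d \/ F2 d).
Hypotheses (r1Z : forall d, Z d -> Z1 (r1 d)) (r2Z : forall d, Z d -> Z2 (r2 d)).
Hypotheses (r1F : forall d, F2 d -> Z1 (r1 d)) (r2F : forall d, F1 d -> Z2 (r2 d)).

Definition glue_fun (u : rel_maps Z1 b0) (v : rel_maps Z2 b0) (d : D) : B :=
  if `[< F1 d >] then proj1_sig u (r1 d) else proj1_sig v (r2 d).

Lemma glue_fun1 u v d : F1 d -> glue_fun u v d = proj1_sig u (r1 d).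
Proof. by move=> F1d; rewrite /glue_fun asboolT. Qed.

(** On the overlap, [r1F] and [r2F] put the two images in [Z1] and [Z2], so both formulas give
    [b0]. *)
Lemma glue_fun2 u v d : F2 d -> glue_fun u v d = proj1_sig v (r2 d).
Proof.
move=> F2d; rewrite /glue_fun; case: asboolP => // F1d.
by rewrite (proj2 (proj2_sig u)) ?(proj2 (proj2_sig v)) //; [exact: r2F | exact: r1F].
Qed.

Lemma glue_subproof (uv : (rel_maps Z1 b0 * rel_maps Z2 b0)%type) :
  continuous (glue_fun uv.1 uv.2) /\
  forall d, Z d -> glue_fun uv.1 uv.2 d = b0.
Proof.
case: uv => -[u [cu uZ]] [v [cv vZ]] /=; split; last first.
  by move=> d Zd; rewrite /glue_fun; case: ifP => _ /=; [exact/uZ/r1Z | exact/vZ/r2Z].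
apply/continuous_closedP => A clA.
rewrite (_ : _ @^-1` A =
  (F1 `&` (u \o r1) @^-1` A) `|` (F2 `&` (v \o r2) @^-1` A)).
  apply: closedU; apply: closedI => //.
  - have /continuous_closedP : continuous (u \o r1); last exact.
    by move=> d; apply: continuous_comp; [exact: cr1 | exact: cu].
  - have /continuous_closedP : continuous (v \o r2); last exact.
    by move=> d; apply: continuous_comp; [exact: cr2 | exact: cv].
apply/seteqP; split => d /=.
- by case: (F12 d) => Fd; [rewrite glue_fun1 // | rewrite glue_fun2 //] => Ad;
    [left | right].
- by case=> -[Fd] Ad; [rewrite glue_fun1 | rewrite glue_fun2].
Qed.

Definition glue (uv : kify (rel_maps Z1 b0 * rel_maps Z2 b0)%type) : rel_maps Z b0 :=
  exist _ _ (glue_subproof uv).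

Lemma glue_continuous : continuous glue.
Proof.
apply: (@kify_continuous (rel_maps Z1 b0 * rel_maps Z2 b0)%type (rel_maps_co Z b0)).
apply: continuous_compact_open => -[u v] K O cK oO uvK.
(* As [F1] and [F2] are closed, [K] is covered by two compact pieces, each a condition on one
   factor. *)
exists ([set f : rel_maps Z1 b0 |
           forall d, (r1 @` (K `&` F1)) d -> O (proj1_sig f d)],
        [set f : rel_maps Z2 b0 |
           forall d, (r2 @` (K `&` F2)) d -> O (proj1_sig f d)]) => /=.
  split; apply: open_nbhs_nbhs; split.
  - apply/open_kify/open_initial_compact_open => //.
    apply: continuous_compact; first exact: continuous_subspaceT.
    exact: compact_closedI.
  - by move=> _ [d [Kd Fd] <-]; have := uvK d Kd; rewrite /= glue_fun1.
  - apply/open_kify/open_initial_compact_open => //.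
    apply: continuous_compact; first exact: continuous_subspaceT.
    exact: compact_closedI.
  - by move=> _ [d [Kd Fd] <-]; have := uvK d Kd; rewrite /= glue_fun2.
move=> [f g] [/= fK gK] d Kd; case: (F12 d) => Fd.
- by rewrite glue_fun1 //; apply: fK; exists d.
- by rewrite glue_fun2 //; apply: gK; exists d.
Qed.

End Glue.

(** * Products of simplices *)

Lemma maxr_cases (R : realDomainType) (a b : R) :
  (a <= b /\ Num.max a b = b) \/ (b <= a /\ Num.max a b = a).
Proof. by have [?|/ltW ?] := leP a b; [left | right]. Qed.

Lemma minr_cases (R : realDomainType) (a b : R) :
  (b <= a /\ Num.min a b = b) \/ (a <= b /\ Num.min a b = a).
Proof. by have [?|/ltW ?] := leP a b; [right | left]. Qed.

Ltac minmax_cases :=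
  repeat match goal with
  | |- context [Order.max ?a ?b] => have [[? ->]|[? ->]] := maxr_cases a b
  | |- context [Order.min ?a ?b] => have [[? ->]|[? ->]] := minr_cases a b
  end.

Section RealContinuity.
Variables (R : realType) (X : topologicalType) (f g : X -> R).
Hypotheses (cf : continuous f) (cg : continuous g).

Lemma addr_continuous : continuous (fun x => f x + g x).
Proof. by move=> x; apply: cvgD; [exact: cf | exact: cg]. Qed.

Lemma subr_continuous : continuous (fun x => f x - g x).
Proof. by move=> x; apply: cvgB; [exact: cf | exact: cg]. Qed.

Lemma mulr_continuous : continuous (fun x => f x * g x).
Proof. by move=> x; apply: cvgM; [exact: cf | exact: cg]. Qed.

Lemma maxr_continuous : continuous (fun x => Num.max (f x) (g x)).
Proof. by move=> x; apply: (@continuous_max R X f g x); [exact: cf | exact: cg]. Qed.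

Lemma minr_continuous : continuous (fun x => Num.min (f x) (g x)).
Proof. by move=> x; apply: (@continuous_min R X f g x); [exact: cf | exact: cg]. Qed.

End RealContinuity.

Lemma sumr_continuous (R : realType) (X : topologicalType) (I : Type)
    (r : seq I) (f : I -> X -> R) :
  (forall i, continuous (f i)) -> continuous (fun x => \sum_(i <- r) f i x).
Proof.
move=> cf; elim: r => [|i r IHr].
  by under eq_fun => x do rewrite big_nil; exact: cst_continuous.
by under eq_fun => x do rewrite big_cons; exact: addr_continuous.
Qed.

Lemma continuous_prod_topology (Y : topologicalType) (I : Type)
    (T : I -> topologicalType) (F : Y -> prod_topology T) :
  (forall i, continuous (fun y => F y i)) -> continuous F.
Proof.
move=> cF y; apply/cvg_sup => i.
exact: (@continuous_comp_initial _ Y (T i) (fun f : (forall i, T i) => f i) F (cF i)).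
Qed.

(* A point of [prism R P] is a point of the product over [k] of the simplices
   of dimension [P k], each presented as the chains
   0 = t_0 <= t_1 <= ... <= t_(P k) <= 1 padded by t_j = 1 for j > P k.  In these
   coordinates the duality between ordinals and intervals becomes reindexing. *)
Definition is_prism (R : realType) (n : nat) (P : dobj n) (t : 'I_n -> nat -> R) :=
  forall k, [/\ t k 0%N = 0,
    (forall i j, (i <= j)%N -> t k i <= t k j) &
    (forall j, (P k < j)%N -> t k j = 1)].

Definition prism_type (R : realType) (n : nat) (P : dobj n) : Type :=
  {t : 'I_n -> nat -> R | is_prism P t}.

HB.instance Definition _ (R : realType) (n : nat) (P : dobj n) :=
  gen_eqMixin (prism_type R P).
HB.instance Definition _ (R : realType) (n : nat) (P : dobj n) :=
  gen_choiceMixin (prism_type R P).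

(** All coordinates live in one function space independent of [P], so reindexing needs no casts;
    those beyond [P k] are constant. *)
Definition prism (R : realType) (n : nat) (P : dobj n) : topologicalType :=
  (@initial_topology (prism_type R P) {ptws ('I_n * nat)%type -> R}
    (fun t kj => proj1_sig t kj.1 kj.2) : topologicalType).

Section Prism.
Variables (R : realType) (n : nat).
Implicit Types P Q S : dobj n.

Definition coord P (t : prism R P) : 'I_n -> nat -> R := proj1_sig t.

Lemma coord0 P (t : prism R P) k : coord t k 0%N = 0.
Proof. by case: (proj2_sig t k). Qed.

Lemma coord_le P (t : prism R P) k i j :
  (i <= j)%N -> coord t k i <= coord t k j.
Proof. by case: (proj2_sig t k) => _ + _; exact. Qed.

Lemma coord1 P (t : prism R P) k j : (P k < j)%N -> coord t k j = 1.
Proof. by case: (proj2_sig t k) => _ _; exact. Qed.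

Lemma coord_ge0 P (t : prism R P) k j : 0 <= coord t k j.
Proof. by rewrite -(coord0 t k); exact: coord_le. Qed.

Lemma coord_le1 P (t : prism R P) k j : coord t k j <= 1.
Proof.
rewrite -(@coord1 _ t k (maxn j (P k).+1)); last by rewrite leq_max ltnS leqnn orbT.
by apply: coord_le; rewrite leq_max leqnn.
Qed.

Lemma prism_eq P (s t : prism R P) :
  (forall k j, (0 < j <= P k)%N -> coord s k j = coord t k j) -> s = t.
Proof.
move=> st; have {}st k j : coord s k j = coord t k j.
  case: j => [|j]; first by rewrite !coord0.
  have [jP|Pj] := leqP j.+1 (P k); first exact: st.
  by rewrite !coord1.
case: s t st => s ps [t pt] st; apply: eq_exist.
by apply/funext => k; apply/funext => j; exact: (st k j).
Qed.

Lemma prism_coord_continuous P k j : continuous (fun t : prism R P => coord t k j).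
Proof.
move=> t; apply: (@continuous_comp (prism R P) {ptws ('I_n * nat)%type -> R} R
  (fun t kj => coord t kj.1 kj.2) (fun u => u (k, j))).
  exact: initial_continuous.
exact: (@proj_continuous _ (fun _ : 'I_n * nat => R : topologicalType) (k, j)).
Qed.

Lemma prism_continuous (Y : topologicalType) P (F : Y -> prism R P) :
  (forall k j, continuous (fun y => coord (F y) k j)) -> continuous F.
Proof.
move=> cF; apply: continuous_comp_initial.
by apply: continuous_prod_topology => -[k j]; exact: cF.
Qed.

(** A chain with values in {0, 1} is a vertex of its simplex. When every [P k] is 1 the marked
    points form the boundary of the cube. *)
Definition marked P : set (prism R P) :=
  [set t | exists k, forall j, coord t k j = 0 \/ coord t k j = 1].

Lemma marked_dim0 P k (t : prism R P) : P k = 0%N -> marked t.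
Proof.
move=> Pk; exists k => -[|j]; first by left; rewrite coord0.
by right; rewrite coord1 // Pk.
Qed.

(** There is no upper bound on [s]: an index above [Q k] reads the padding [1] of the point pulled
    back, which is how a front face arises. Monotonicity stops at [P k] because [pull_fun]
    overwrites later coordinates with [1]. *)
Definition reindexing P (s : 'I_n -> nat -> nat) :=
  forall k, s k 0%N = 0%N /\ forall i j, (i <= j <= P k)%N -> (s k i <= s k j)%N.

Definition pull_fun P Q (s : 'I_n -> nat -> nat) (t : prism R Q) k j : R :=
  if (j <= P k)%N then coord t k (s k j) else 1.

Lemma pull_subproof P Q s (t : prism R Q) :
  reindexing P s -> is_prism P (pull_fun P s t).
Proof.
move=> ok k; have [s0 sle] := ok k; rewrite /pull_fun; split.
- by rewrite s0 coord0.
- move=> i j ij; have [iP|iP] := leqP i (P k); have [jP|jP] := leqP j (P k).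
  + by apply/coord_le/sle/andP.
  + exact: coord_le1.
  + by have := leq_ltn_trans (leq_trans ij jP) iP; rewrite ltnn.
  + by [].
- by move=> j; rewrite ltnNge => /negbTE ->.
Qed.

Definition pull P Q s (ok : reindexing P s) (t : prism R Q) : prism R P :=
  exist _ _ (pull_subproof t ok).

Lemma coord_pull P Q s (ok : reindexing P s) (t : prism R Q) k j :
  coord (pull ok t) k j = if (j <= P k)%N then coord t k (s k j) else 1.
Proof. by []. Qed.

Lemma pull_continuous P Q s (ok : reindexing P s) :
  continuous (@pull P Q s ok).
Proof.
apply: prism_continuous => k j.
rewrite (_ : (fun _ => _) =
  fun t : prism R Q => if (j <= P k)%N then coord t k (s k j) else 1) //.
by case: (j <= P k)%N; [exact: prism_coord_continuous | exact: cst_continuous].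
Qed.

Lemma pull_marked P Q s (ok : reindexing P s) (t : prism R Q) :
  marked t -> marked (pull ok t).
Proof.
by case=> k tk; exists k => j; rewrite coord_pull; case: ifP => _; [exact: tk | right].
Qed.

Lemma front_reindexing P : reindexing P (fun _ j => j).
Proof. by move=> k; split => // i j /andP[]. Qed.

(** Truncated subtraction sends the indices up to [Q k] to [0], where every chain is [0]: the
    defining condition of the back face. *)
Definition back_shift (i : 'I_n) Q : 'I_n -> nat -> nat :=
  fun k j => if k == i then (j - Q k)%N else j.

Lemma back_reindexing P i Q : reindexing P (back_shift i Q).
Proof.
move=> k; rewrite /back_shift; split; first by case: ifP.
by move=> a b /andP[ab _]; case: ifP => // _; exact: leq_sub2r.
Qed.

Lemma ordfunE a b (f : 'I_a -> 'I_b) m (ma : (m < a)%N) :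
  ordfun f m = f (Ordinal ma).
Proof. by rewrite /ordfun insubT. Qed.

Lemma ordfun_lt a b (f : 'I_a -> 'I_b) m : (m < a)%N -> (ordfun f m < b)%N.
Proof. by move=> ma; rewrite ordfunE. Qed.

(** Element [m] of the ordinal corresponds to coordinate [m + 1], coordinate [0] being the fixed
    left end; hence the two successors. *)
Definition hom_shift P Q (h : dhom P Q) : 'I_n -> nat -> nat :=
  fun k j => if j is m.+1 then (ordfun (dhomf h k) m).+1 else 0%N.

Lemma hom_reindexing P Q (h : dhom P Q) : reindexing P (hom_shift h).
Proof.
move=> k; split => // -[|i] [|j] //= /andP[ij jP].
have iP := leq_trans ij jP.
rewrite ltnS (ordfunE _ iP) (ordfunE _ jP).
exact: (proj2_sig (h k)).
Qed.

End Prism.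

Arguments coord : simpl never.

(* With q = Q i, a = t_q and b = t_(q+1), the retraction [pinch_fun] lowers
   t_1, ..., t_q by 1 - b and raises the other coordinates by a, truncating to
   [0, 1].  It lands in the front face where a + b >= 1 and in the back face
   where a + b <= 1; [pinch_front] and [pinch_back] are its components. *)
Section PinchMaps.
Variables (R : realType) (n : nat) (i : 'I_n) (P Q S : dobj n).
Hypothesis PQS : splits i P Q S.
Implicit Types t : prism R P.

Lemma splits_cases k :
  if k == i then P k = (Q k + S k)%N else Q k = P k /\ S k = P k.
Proof. by case: PQS => Pi Pk; case: eqVneq => [->|/Pk]. Qed.

(** For [Q i = 0] this reads [t_0 = 0], and for [S i = 0] [pinch_hi] reads the padding [1], so
    degenerate splittings need no separate case. *)
Definition pinch_lo t : R := coord t i (Q i).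
Definition pinch_hi t : R := coord t i (Q i).+1.

Definition pinch_front_fun t k j : R :=
  if k == i then
    if (j <= Q k)%N then Num.max 0 (coord t k j - 1 + pinch_hi t) else 1
  else coord t k j.

(** Coordinate [0] is set by hand, as the formula would give min(1, 2 t_q) there. *)
Definition pinch_back_fun t k j : R :=
  if k == i then
    if j is 0 then 0 else Num.min 1 (coord t k (j + Q k)%N + pinch_lo t)
  else coord t k j.

Definition unit_clamp (s : R) : R := Num.max 0 (Num.min 1 s).

Lemma unit_clamp_itv s : 0 <= unit_clamp s <= 1.
Proof.
by rewrite /unit_clamp; have [[? ->]|[? ->]] := minr_cases 1 s;
  minmax_cases; apply/andP; split; lra.
Qed.

Definition pinch_fun t k j : R :=
  if k == i then
    if (j <= Q k)%N then Num.max 0 (coord t k j - 1 + pinch_hi t)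
    else Num.min 1 (coord t k j + pinch_lo t)
  else coord t k j.

(* Clamping the time makes the homotopy defined for all real times. *)
Definition pinch_homotopy_fun (w : (prism R P * R)%type) k j : R :=
  unit_clamp w.2 * coord w.1 k j + (1 - unit_clamp w.2) * pinch_fun w.1 k j.

Lemma pinch_front_subproof t : is_prism Q (pinch_front_fun t).
Proof.
move=> k; have := splits_cases k; rewrite /pinch_front_fun /pinch_hi.
have b1 := coord_le1 t i (Q i).+1; have b0 := coord_ge0 t i (Q i).+1.
case: eqVneq => [->|ki] H; split.
- by rewrite coord0 /=; apply/max_idPl; lra.
- move=> a b ab; have [aQ|aQ] := leqP a (Q i); have [bQ|bQ] := leqP b (Q i) => //;
    last by exfalso; lia.
    by have := coord_le t i ab => ?; minmax_cases; lra.
  by have := coord_le1 t i a => ?; minmax_cases; lra.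
- by move=> j; rewrite ltnNge => /negbTE ->.
- by rewrite coord0.
- by move=> a b; exact: coord_le.
- by move=> j; rewrite H.1; exact: coord1.
Qed.

Lemma pinch_back_subproof t : is_prism S (pinch_back_fun t).
Proof.
move=> k; have := splits_cases k; rewrite /pinch_back_fun /pinch_lo.
have a1 := coord_le1 t i (Q i); have a0 := coord_ge0 t i (Q i).
case: eqVneq => [->|ki] H; split => //.
- move=> [|a] [|b] ab //.
    by have := coord_ge0 t i (b.+1 + Q i)%N => ?; minmax_cases; lra.
  have /(coord_le t i) : (a.+1 + Q i <= b.+1 + Q i)%N by rewrite leq_add2r.
  by move=> ?; minmax_cases; lra.
- by case=> // j Sj; rewrite coord1; [apply/min_idPl; lra | lia].
- by rewrite coord0.
- by move=> a b; exact: coord_le.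
- by move=> j; rewrite H.2; exact: coord1.
Qed.

Lemma pinch_homotopy_subproof w : is_prism P (pinch_homotopy_fun w).
Proof.
case: w => t s k; rewrite /pinch_homotopy_fun /=.
have /andP[c0 c1] := unit_clamp_itv s.
have {}c1 : 0 <= 1 - unit_clamp s by lra.
have : is_prism P (pinch_fun t); last first.
  case/(_ k) => p0 ple p1; split.
  - by rewrite coord0 p0 !mulr0 addr0.
  - by move=> a b ab; apply: lerD; apply: ler_wpM2l => //; [exact: coord_le | exact: ple].
  - by move=> j Pj; rewrite p1 // coord1 //; ring.
move=> {}k; have := splits_cases k; rewrite /pinch_fun /pinch_lo /pinch_hi.
have a1 := coord_le1 t i (Q i); have a0 := coord_ge0 t i (Q i).
have b1 := coord_le1 t i (Q i).+1; have b0 := coord_ge0 t i (Q i).+1.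
case: eqVneq => [->|ki] H; split.
- by rewrite coord0 /=; apply/max_idPl; lra.
- move=> a b ab; have := coord_le t i ab => tab.
  have := coord_ge0 t i a; have := coord_le1 t i a; have := coord_le1 t i b => ? ? ?.
  have [aQ|aQ] := leqP a (Q i); have [bQ|bQ] := leqP b (Q i) .
  + by minmax_cases; lra.
  + by minmax_cases; lra.
  + by exfalso; lia.
  + by minmax_cases; lra.
- move=> j Pj; rewrite leqNgt (_ : (Q i < j)%N) /=; last by lia.
  by rewrite coord1 //; apply/min_idPl; lra.
- by rewrite coord0.
- by move=> a b; exact: coord_le.
- by move=> j; exact: coord1.
Qed.

Definition pinch_front t : prism R Q := exist _ _ (pinch_front_subproof t).
Definition pinch_back t : prism R S := exist _ _ (pinch_back_subproof t).
Definition pinch_homotopy w : prism R P := exist _ _ (pinch_homotopy_subproof w).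

Lemma coord_pinch_front t k j : coord (pinch_front t) k j = pinch_front_fun t k j.
Proof. by []. Qed.

Lemma coord_pinch_back t k j : coord (pinch_back t) k j = pinch_back_fun t k j.
Proof. by []. Qed.

Lemma coord_pinch_homotopy w k j :
  coord (pinch_homotopy w) k j = pinch_homotopy_fun w k j.
Proof. by []. Qed.

Lemma pinch_front_coord_continuous j :
  continuous (fun t => Num.max 0 (coord t i j - 1 + pinch_hi t)).
Proof.
apply: maxr_continuous; first exact: cst_continuous.
apply: addr_continuous; last exact: prism_coord_continuous.
by apply: subr_continuous; [exact: prism_coord_continuous | exact: cst_continuous].
Qed.

Lemma pinch_back_coord_continuous j :
  continuous (fun t => Num.min 1 (coord t i j + pinch_lo t)).
Proof.
apply: minr_continuous; first exact: cst_continuous.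
by apply: addr_continuous; exact: prism_coord_continuous.
Qed.

Lemma pinch_front_continuous : continuous pinch_front.
Proof.
apply: prism_continuous => k j; rewrite /coord /= /pinch_front_fun.
case: eqVneq => [->|_]; last exact: prism_coord_continuous.
by case: (j <= Q i)%N; [exact: pinch_front_coord_continuous | exact: cst_continuous].
Qed.

Lemma pinch_back_continuous : continuous pinch_back.
Proof.
apply: prism_continuous => k j; rewrite /coord /= /pinch_back_fun.
case: eqVneq => [->|_]; last exact: prism_coord_continuous.
by case: j => [|j]; [exact: cst_continuous | exact: pinch_back_coord_continuous].
Qed.

Lemma unit_clamp_continuous : continuous unit_clamp.
Proof.
apply: maxr_continuous; first exact: cst_continuous.
by apply: minr_continuous; [exact: cst_continuous | move=> x; exact: cvg_id].
Qed.

Lemma pinch_homotopy_continuous : continuous pinch_homotopy.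
Proof.
have c1 (f : prism R P -> R) : continuous f ->
    continuous (fun w : prism R P * R => f w.1).
  by move=> cf w; apply: continuous_comp; [exact: cvg_fst | exact: cf].
have c2 : continuous (fun w : prism R P * R => unit_clamp w.2).
  by move=> w; apply: continuous_comp; [exact: cvg_snd | exact: unit_clamp_continuous].
apply: prism_continuous => k j; rewrite /coord /= /pinch_homotopy_fun.
apply: addr_continuous; apply: mulr_continuous => //.
- by apply: (c1 (fun t => coord t k j)); exact: prism_coord_continuous.
- by apply: subr_continuous => //; exact: cst_continuous.
- apply: (c1 (fun t => pinch_fun t k j)); rewrite /pinch_fun;
  case: eqVneq => [->|_]; last exact: prism_coord_continuous.
  by case: (j <= Q i)%N;
    [exact: pinch_front_coord_continuous | exact: pinch_back_coord_continuous].
Qed.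

Lemma pinch_front_marked t : marked t -> marked (pinch_front t).
Proof.
case=> k tk; exists k => j; rewrite coord_pinch_front /pinch_front_fun.
case: eqVneq tk => [->|_] tk; last exact: tk.
case: ifP => _; last by right.
rewrite /pinch_hi; case: (tk j) => ->; case: (tk (Q i).+1) => ->; minmax_cases;
  by [left; lra | right; lra | exfalso; lra].
Qed.

Lemma pinch_back_marked t : marked t -> marked (pinch_back t).
Proof.
case=> k tk; exists k => j; rewrite coord_pinch_back /pinch_back_fun.
case: eqVneq tk => [->|_] tk; last exact: tk.
case: j => [|j]; first by left.
rewrite /pinch_lo; case: (tk (j.+1 + Q i)%N) => ->; case: (tk (Q i)) => ->; minmax_cases;
  by [left; lra | right; lra | exfalso; lra].
Qed.

(** A vertex jumps once from 0 to 1, so it has [t_(q+1) = 1] (front face) or [t_q = 0] (back face).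
    [pinch_fun] fixes both faces, hence the straight line is constant in the marked component. *)
Lemma pinch_homotopy_marked t s : marked t -> marked (pinch_homotopy (t, s)).
Proof.
case=> k tk; exists k => j; rewrite coord_pinch_homotopy /pinch_homotopy_fun /=.
have -> : pinch_fun t k j = coord t k j; last first.
  rewrite -mulrDl addrC subrK mul1r; exact: tk.
rewrite /pinch_fun; case: eqVneq tk => [->|//] tk.
rewrite /pinch_hi /pinch_lo; case: leqP => jQ.
- have := coord_le t i (leqW jQ).
  by case: (tk j) => ->; case: (tk (Q i).+1) => -> ?; minmax_cases; lra.
- have := coord_le t i (ltnW jQ).
  by case: (tk j) => ->; case: (tk (Q i)) => -> ?; minmax_cases; lra.
Qed.

Definition pinch_first : set (prism R P) := [set t | 1 <= pinch_lo t + pinch_hi t].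
Definition pinch_last : set (prism R P) := [set t | pinch_lo t + pinch_hi t <= 1].

Lemma pinch_sum_continuous : continuous (fun t => pinch_lo t + pinch_hi t).
Proof. by apply: addr_continuous; exact: prism_coord_continuous. Qed.

Lemma closed_pinch_first : closed pinch_first.
Proof.
exact: ((continuous_closedP _).1 pinch_sum_continuous _ (@closed_ge R 1)).
Qed.

Lemma closed_pinch_last : closed pinch_last.
Proof.
exact: ((continuous_closedP _).1 pinch_sum_continuous _ (@closed_le R 1)).
Qed.

Lemma pinch_cover t : pinch_first t \/ pinch_last t.
Proof.
rewrite /pinch_first /pinch_last /=.
by have [?|/ltW ?] := leP 1 (pinch_lo t + pinch_hi t); [left | right].
Qed.

(** Where [t_q + t_(q+1) <= 1], each [t_j - 1 + t_(q+1)] with [j <= q] is at most 0, so the front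
    component is the vertex shared by the two faces. This and the next lemma provide [r1F] and [r2F]
    for [glue]. *)
Lemma pinch_front_last t : pinch_last t -> marked (pinch_front t).
Proof.
rewrite /pinch_last /= /pinch_lo /pinch_hi => tl.
exists i => j; rewrite coord_pinch_front /pinch_front_fun eqxx /pinch_hi.
case: leqP => [jQ|_]; last by right.
by have := coord_le t i jQ => ?; left; apply/max_idPl; lra.
Qed.

Lemma pinch_back_first t : pinch_first t -> marked (pinch_back t).
Proof.
rewrite /pinch_first /= /pinch_lo /pinch_hi => tl.
exists i => -[|j]; rewrite coord_pinch_back /pinch_back_fun eqxx; first by left.
have /(coord_le t i) : ((Q i).+1 <= j.+1 + Q i)%N by lia.
by rewrite /pinch_lo => ?; right; apply/min_idPl; lra.
Qed.

End PinchMaps.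

(** * The algebra of loops *)

Lemma ordfun_comp a b c (f : 'I_a -> 'I_b) (g : 'I_b -> 'I_c) m :
  (m < a)%N -> ordfun (g \o f) m = ordfun g (ordfun f m).
Proof.
move=> ma; rewrite (ordfunE (g \o f) ma) (ordfunE f ma) (ordfunE g (ltn_ord _)) /=.
by congr (nat_of_ord (g _)); apply: val_inj.
Qed.

Section LoopAlgebra.
Variables (R : realType) (n : nat) (B : topologicalType) (b0 : B).
Hypothesis hB : hausdorff_space B.
Implicit Types P Q S : dobj n.

Definition loops P : topologicalType := rel_maps (@marked R n P) b0.

Definition restrict P Q s (ok : reindexing P s) : loops P -> loops Q :=
  precomp (@pull_continuous R n P Q s ok) (@pull_marked R n P Q s ok).

Lemma restrict_continuous P Q s (ok : reindexing P s) :
  continuous (@restrict P Q s ok).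
Proof. exact: precomp_continuous. Qed.

Lemma restrictE P Q s (ok : reindexing P s) (x : loops P) t :
  proj1_sig (@restrict P Q s ok x) t = proj1_sig x (pull ok t).
Proof. by []. Qed.

Definition loops_map P Q (h : dhom P Q) : loops P -> loops Q :=
  restrict Q (hom_reindexing h).

Definition loops_front P Q : loops P -> loops Q := restrict Q (front_reindexing P).

Definition loops_back (i : 'I_n) P Q S : loops P -> loops S :=
  restrict S (back_reindexing P i Q).

Definition loops_split (i : 'I_n) P Q S (x : loops P) :
  kify (loops Q * loops S)%type := (loops_front Q x, loops_back i Q S x).

Lemma loops_split_continuous i P Q S : continuous (@loops_split i P Q S).
Proof.
apply: (@kspace_continuous _ (loops Q * loops S)%type); first exact: kspace_kify.
move=> x; have cF : continuous (@loops_front P Q) by exact: restrict_continuous.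
have cB : continuous (@loops_back i P Q S) by exact: restrict_continuous.
exact: (cvg_pair (cF x) (cB x)).
Qed.

Lemma hom_shift_le P Q (h : dhom P Q) k j :
  (j <= P k)%N -> (hom_shift h k j <= Q k)%N.
Proof. by case: j => // j jP; exact: ordfun_lt. Qed.

Lemma loops_map_id P (x : loops P) : loops_map (did P) x = x.
Proof.
apply: rel_maps_eq => t; congr (proj1_sig x _); apply: prism_eq => k j.
rewrite coord_pull => /andP[j0 jP]; rewrite jP; case: j j0 jP => // j _ jP /=.
by rewrite ordfunE.
Qed.

Lemma loops_map_comp P Q S (f : dhom P Q) (g : dhom Q S) (x : loops P) :
  loops_map (Defs.dcomp g f) x = loops_map g (loops_map f x).
Proof.
apply: rel_maps_eq => t; congr (proj1_sig x _); apply: prism_eq => k j.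
rewrite !coord_pull => /andP[j0 jP]; rewrite jP hom_shift_le //.
case: j j0 jP => // j _ jP /=; congr (coord t k _.+1).
exact: ordfun_comp.
Qed.

Lemma loops_split_natural i P Q S P' Q' S' (h : dhom P P') (f : dhom Q Q')
    (g : dhom S S') (x : loops P) :
  splits i P Q S -> splits i P' Q' S' -> is_sum_hom i h f g ->
  loops_split i Q' S' (loops_map h x) =
  (loops_map f (loops_split i Q S x).1, loops_map g (loops_split i Q S x).2).
Proof.
move=> sp sp' [hk [hQ hS]]; congr pair.
- apply: rel_maps_eq => t; congr (proj1_sig x _); apply: prism_eq => k j.
  rewrite !coord_pull => /andP[j0 jP]; rewrite jP hom_shift_le //.
  case: j j0 jP => // j _ jP.
  have := splits_cases sp k; have := splits_cases sp' k.
  have [ki|ki] := eqVneq k i => H' H; last first.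
    by rewrite H.1 jP /= (hk k ki).1.
  subst k; have [jQ|jQ] := ltnP j (Q i); first by rewrite /= hQ.
  (* An index [j >= Q i] is governed by [g]: [h] carries it past [Q' i], so both sides are the
     padding [1]. *)
  rewrite coord1 //= ltnS (_ : j = Q i + (j - Q i))%N; last by lia.
  by rewrite hS; lia.
- apply: rel_maps_eq => t; congr (proj1_sig x _); apply: prism_eq => k j.
  rewrite !coord_pull => /andP[j0 jP]; rewrite jP hom_shift_le // /back_shift.
  case: j j0 jP => // j _ jP.
  have := splits_cases sp k; have := splits_cases sp' k.
  have [ki|ki] := eqVneq k i => H' H; last first.
    by rewrite H.2 jP /= (hk k ki).2.
  subst k; rewrite leq_subLR -H jP.
  (* Indices below [Q i] truncate to [0] on both sides, since [f] keeps them below [Q' i]. *)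
  have [jQ|Qj] := ltnP j (Q i).
    have -> : (j.+1 - Q i = 0)%N by lia.
    have -> : (hom_shift h i j.+1 - Q' i = 0)%N; last by [].
    by rewrite /= hQ //; have := ordfun_lt (dhomf f i) jQ; lia.
  rewrite subSn //=; congr coord.
  by rewrite -{1}(subnKC Qj) hS; lia.
Qed.

Ltac reindex_cases t :=
  repeat case: ifP; intros;
  try solve [ congr (coord t _ _); lia | rewrite !coord1; lia
            | rewrite coord1 //; lia | by exfalso; lia ].

(** Both ways of splitting twice restrict to the same three consecutive faces: truncated
    subtractions add up, and indices past an end read [0] or [1]. *)
Lemma loops_split_coassoc i P A0 B0 C AB BC (x : loops P) :
  splits i P AB C -> splits i AB A0 B0 -> splits i P A0 BC -> splits i BC B0 C ->
  let u := loops_split i AB C x in let v := loops_split i A0 B0 u.1 in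
  let u' := loops_split i A0 BC x in let v' := loops_split i B0 C u'.2 in
  [/\ v.1 = u'.1, v.2 = v'.1 & u.2 = v'.2].
Proof.
move=> s1 s2 s3 s4 /=.
split; apply: rel_maps_eq => t; congr (proj1_sig x _);
  apply: prism_eq => k j /andP[j0 jP]; rewrite !coord_pull /back_shift;
  have := splits_cases s1 k; have := splits_cases s2 k;
  have := splits_cases s3 k; have := splits_cases s4 k; reindex_cases t.
Qed.

Lemma loops_split_counitl i P Z (x : loops P) :
  splits i P Z P -> Z i = 0%N -> (loops_split i Z P x).2 = x.
Proof.
move=> sp Z0; apply: rel_maps_eq => t; congr (proj1_sig x _).
apply: prism_eq => k j /andP[j0 jP]; rewrite coord_pull jP /back_shift.
by case: eqVneq => [->|//]; rewrite Z0 subn0.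
Qed.

Lemma loops_split_counitr i P Z (x : loops P) :
  (loops_split i P Z x).1 = x.
Proof.
apply: rel_maps_eq => t; congr (proj1_sig x _).
by apply: prism_eq => k j /andP[j0 jP]; rewrite coord_pull jP.
Qed.

Lemma loops_split_interchange (i j : 'I_n) P Q S Q1 Q2 S1 S2 U V (x : loops P) :
  i != j ->
  splits i P Q S -> splits j Q Q1 Q2 -> splits j S S1 S2 ->
  splits j P U V -> splits i U Q1 S1 -> splits i V Q2 S2 ->
  let a := loops_split i Q S x in let b := loops_split j U V x in
  loops_split j Q1 Q2 a.1 =
    ((loops_split i Q1 S1 b.1).1, (loops_split i Q2 S2 b.2).1) /\
  loops_split j S1 S2 a.2 =
    ((loops_split i Q1 S1 b.1).2, (loops_split i Q2 S2 b.2).2).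
Proof.
move=> ij s1 s2 s3 s4 s5 s6 /=.
(* At most one of the two back shifts acts in a given variable [k]. *)
have nij k : ~~ ((k == i) && (k == j)).
  by apply: contra ij => /andP[/eqP <- /eqP <-].
split; congr pair; apply: rel_maps_eq => t; congr (proj1_sig x _);
  apply: prism_eq => k m /andP[m0 mP]; rewrite !coord_pull /back_shift;
  have := nij k;
  have := splits_cases s1 k; have := splits_cases s2 k;
  have := splits_cases s3 k; have := splits_cases s4 k;
  have := splits_cases s5 k; have := splits_cases s6 k; reindex_cases t.
Qed.

(** For [n = 1] and [Q i = S i = 1], composing with the map [2 -> 1] of Delta restricts to the
    points [(t, t)] and gives loop concatenation: the second loop at double speed for [t <= 1/2],
    then the first. *)
Definition loops_join (i : 'I_n) P Q S (sp : splits i P Q S) :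
    kify (loops Q * loops S)%type -> loops P :=
  @glue _ _ _ B _ _ _ b0 _ _ _ _
    (@pinch_front_continuous R n i P Q S sp) (@pinch_back_continuous R n i P Q S sp)
    (@closed_pinch_first R n i P Q) (@closed_pinch_last R n i P Q)
    (@pinch_cover R n i P Q)
    (@pinch_front_marked R n i P Q S sp) (@pinch_back_marked R n i P Q S sp)
    (@pinch_front_last R n i P Q S sp) (@pinch_back_first R n i P Q S sp).

Lemma loops_join_first i P Q S (sp : splits i P Q S) uv t :
  pinch_first i Q t ->
  proj1_sig (loops_join sp uv) t = proj1_sig uv.1 (pinch_front sp t).
Proof. exact: glue_fun1. Qed.

Lemma loops_join_last i P Q S (sp : splits i P Q S) uv t :
  pinch_last i Q t ->
  proj1_sig (loops_join sp uv) t = proj1_sig uv.2 (pinch_back sp t).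
Proof.
apply: glue_fun2; [exact: pinch_front_last | exact: pinch_back_first].
Qed.

Lemma marked_loops P (x : loops P) t : marked t -> proj1_sig x t = b0.
Proof. by case: x => x [cx xm] /= /xm. Qed.

(** The retraction is the identity on the two faces: front-face points have [t_(q+1) = 1], so
    nothing is lowered, and back-face points have [t_q = 0], so nothing is raised. *)
Lemma loops_split_joinK i P Q S (sp : splits i P Q S) :
  cancel (loops_join sp) (@loops_split i P Q S).
Proof.
move=> [u v]; congr pair; apply: rel_maps_eq => t.
- have tQ : coord t i (Q i).+1 = 1 by rewrite coord1.
  have tF : pinch_first i Q (@pull R n P Q _ (front_reindexing P) t).
    rewrite /pinch_first /= /pinch_lo /pinch_hi !coord_pull.
    have := coord_ge0 t i (Q i); rewrite (_ : (Q i <= P i)%N); last first.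
      by have := splits_cases sp i; rewrite eqxx; lia.
    by case: ifP => _ ?; rewrite ?tQ; lra.
  rewrite restrictE loops_join_first //; congr (proj1_sig u _).
  apply: prism_eq => k j /andP[j0 jQ]; rewrite coord_pinch_front /pinch_front_fun.
  have := splits_cases sp k; case: eqVneq jQ => [->|ki] jQ H; last first.
    by rewrite coord_pull -H.1 jQ.
  rewrite jQ /pinch_hi !coord_pull tQ (_ : (j <= P i)%N); last by lia.
  by have := coord_ge0 t i j => ?; case: ifP => _; minmax_cases; lra.
- set b := @pull R n P S _ (back_reindexing P i Q) t; rewrite restrictE.
  have bE k j : coord b k j = if (j <= P k)%N then
      coord t k (if k == i then j - Q k else j)%N else 1 by [].
  have sum1 : coord b i (Q i) = 0.
    by rewrite bE eqxx subnn coord0; case: ifP => //; have := splits_cases sp i; rewrite eqxx; lia.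
  (* Since [t_q = 0] on the back face, it meets [pinch_first] only where the component in variable
     [i] is the common vertex; both sides are then [b0]. *)
  have [bF|bL] := pinch_cover i Q b.
    have bh : coord b i (Q i).+1 = 1.
      move: bF; rewrite /pinch_first /= /pinch_lo /pinch_hi sum1 add0r => h.
      by apply/eqP; rewrite eq_le h coord_le1.
    rewrite loops_join_first // !marked_loops //.
      exists i => -[|j]; first by left; rewrite coord0.
      right; apply/eqP; rewrite eq_le coord_le1 /=.
      have : coord t i 1 = 1.
        move: bh; rewrite bE eqxx subSn // subnn.
        by case: leqP => // PQ _; rewrite coord1 //; have := splits_cases sp i; rewrite eqxx; lia.
      by move=> <-; exact: coord_le.
    exists i => j; rewrite coord_pinch_front /pinch_front_fun eqxx /pinch_hi bh.
    case: ifP => [jQ|_]; last by right.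
    have := coord_le b i jQ; rewrite sum1 => b0'; have := coord_ge0 b i j => ?.
    by left; minmax_cases; lra.
  rewrite loops_join_last //; congr (proj1_sig v _).
  apply: prism_eq => k j /andP[j0 jS]; rewrite coord_pinch_back /pinch_back_fun.
  have := splits_cases sp k; case: eqVneq jS => [->|ki] jS H; last first.
    by rewrite bE (negbTE ki) -H.2 jS.
  case: j j0 jS => // j _ jS; rewrite /pinch_lo sum1 addr0 bE eqxx addnK.
  rewrite (_ : (j.+1 + Q i <= P i)%N); last by lia.
  by apply/min_idPr; exact: coord_le1.
Qed.

Lemma pinch_homotopy0 i P Q S (sp : splits i P Q S) t (x : loops P) :
  proj1_sig (loops_join sp (loops_split i Q S x)) t =
  proj1_sig x (pinch_homotopy sp (t, 0)).
Proof.
have c0 : unit_clamp (0 : R) = 0 by rewrite /unit_clamp; minmax_cases; lra.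
have hE k j : coord (pinch_homotopy sp (t, 0)) k j = pinch_fun i Q t k j.
  by rewrite coord_pinch_homotopy /pinch_homotopy_fun /= c0 mul0r add0r subr0 mul1r.
have [tF|tL] := pinch_cover i Q t.
- rewrite loops_join_first //; congr (proj1_sig x _).
  apply: prism_eq => k j /andP[j0 jP].
  rewrite hE coord_pull jP coord_pinch_front /pinch_front_fun /pinch_fun.
  case: eqVneq jP => [->|//] jP; have [//|Qj] := leqP j (Q i).
  (* Here [j > Q i], so [t_j + t_q >= t_(q+1) + t_q >= 1] and truncation yields the padding [1] of
     the front face. *)
  symmetry; apply/min_idPl; have := coord_le t i Qj.
  by move: tF; rewrite /pinch_first /= /pinch_lo /pinch_hi; lra.
- rewrite loops_join_last //; congr (proj1_sig x _).
  apply: prism_eq => k j /andP[j0 jP].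
  rewrite hE coord_pull jP coord_pinch_back /pinch_back_fun /pinch_fun /back_shift.
  case: eqVneq jP => [->|//] jP; have [jQ|Qj] := leqP j (Q i).
    rewrite (_ : (j - Q i = 0)%N); last by lia.
    symmetry; apply/max_idPl; have := coord_le t i jQ.
    by move: tL; rewrite /pinch_last /= /pinch_lo /pinch_hi; lra.
  case E : (j - Q i)%N => [|m]; first by lia.
  by congr (Num.min 1 (coord t i _ + _)); lia.
Qed.

Lemma pinch_homotopy1 i P Q S (sp : splits i P Q S) (t : prism R P) :
  pinch_homotopy sp (t, 1) = t.
Proof.
have c1 : unit_clamp (1 : R) = 1.
  by rewrite /unit_clamp minxx; apply/max_idPr; lra.
apply: prism_eq => k j _.
by rewrite coord_pinch_homotopy /pinch_homotopy_fun /= c1 mul1r subrr mul0r addr0.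
Qed.

Lemma loops_split_equivalence i P Q S :
  splits i P Q S -> homotopy_equivalence R (@loops_split i P Q S).
Proof.
move=> sp; split; first exact: loops_split_continuous.
exists (loops_join sp); split; first exact: glue_continuous.
split.
  exists (@precomp_homotopy _ _ R B _ _ b0 _ (@pinch_homotopy_continuous R n i P Q S sp)
           (fun e s => @pinch_homotopy_marked R n i P Q S sp e s)).
  split.
    apply: continuous_subspaceT.
    exact/precomp_homotopy_continuous/has_compact_nbhs_real.
  move=> x; split; apply: rel_maps_eq => t; first by rewrite pinch_homotopy0.
  by rewrite /= pinch_homotopy1.
(* This composite is the identity, so the constant homotopy serves. *)
exists fst; split; first by apply: continuous_subspaceT => x; exact: cvg_fst.
by move=> uv; rewrite loops_split_joinK.
Qed.

(** A 0-dimensional simplex is a single vertex, so every point is marked and the constant map is the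
    only element of [loops P]. *)
Lemma loops_counit_equivalence i P :
  P i = 0%N -> homotopy_equivalence R (fun _ : loops P => (tt : one_space R)).
Proof.
move=> Pi.
have c0 : continuous (fun _ : prism R P => b0) by exact: cst_continuous.
pose x0 : loops P := exist _ (fun=> b0) (conj c0 (fun _ _ => erefl)).
have all_eq (x y : loops P) : x = y.
  by apply: rel_maps_eq => t; rewrite !marked_loops //; exact: (@marked_dim0 _ _ _ i).
split; first exact: cst_continuous.
exists (fun=> x0); split; first exact: cst_continuous.
split; exists fst; split; try by apply: continuous_subspaceT => x; exact: cvg_fst.
- by move=> x; split => //; exact: all_eq.
- by case.
Qed.

Lemma loops_algebra : homotopy_mon_algebra R loops_map loops_split.
Proof.
split.
- by move=> P; exact: CGH_rel_maps.
- split; first by move=> P Q h; exact: restrict_continuous.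
  split; [exact: loops_map_id | exact: loops_map_comp].
- split; first by move=> i P Q S _; exact: loops_split_continuous.
  by move=> i P Q S P' Q' S' h f g sp sp' hfg x; exact: (loops_split_natural x sp sp' hfg).
- split; first by move=> i P A0 B0 C AB BC s1 s2 s3 s4 x;
    exact: (loops_split_coassoc x s1 s2 s3 s4).
  split; first by move=> i P Z sp Z0 x; exact: (loops_split_counitl x sp Z0).
  split; first by move=> i P Z _ _ x; exact: loops_split_counitr.
  move=> i j ij P Q S Q1 Q2 S1 S2 U V s1 s2 s3 s4 s5 s6 x.
  by apply: (loops_split_interchange x _ s1 s2 s3 s4 s5 s6); rewrite neq_ltn ij.
- by split; [exact: loops_split_equivalence | exact: loops_counit_equivalence].
Qed.

End LoopAlgebra.

(** * The cube modulo its boundary is the sphere *)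

Lemma hausdorff_injective (S T : topologicalType) (f : S -> T) :
  continuous f -> injective f -> hausdorff_space T -> hausdorff_space S.
Proof.
move=> cf fI hT p q pq; apply/fI/hT => A N nA nN.
have [s [As Ns]] := pq _ _ (cf p A nA) (cf q N nN).
by exists (f s).
Qed.

Section RelativeHomeomorphism.
Variables (D E B : topologicalType) (ZD : set D) (ZE : set E) (b0 : B).
Variables (q : D -> E) (g : E -> D).
Hypotheses (cD : compact [set: D]) (hE : hausdorff_space E) (clZE : closed ZE).
Hypothesis cq : continuous q.
Hypothesis qZ : forall d, ZE (q d) <-> ZD d.
Hypotheses (qK : forall d, ~ ZD d -> g (q d) = d)
           (gK : forall e, ~ ZE e -> q (g e) = e).

Lemma closed_image_compact (A : set D) : closed A -> closed (q @` A).
Proof.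
move=> clA; apply: compact_closed => //; apply: continuous_compact.
  exact: continuous_subspaceT.
exact: subclosed_compact clA cD _.
Qed.

(** [g] is only a set-theoretic inverse off [ZE]. Continuity of the descended map comes from [q]
    being closed, as a map from a compact space to a Hausdorff one. *)
Definition descend_fun (f : rel_maps ZD b0) (e : E) : B :=
  if `[< ZE e >] then b0 else proj1_sig f (g e).

Lemma descend_funK f d : descend_fun f (q d) = proj1_sig f d.
Proof.
rewrite /descend_fun; case: asboolP => qd; last by rewrite qK // => /qZ.
by case: f => f [cf fZ] /=; rewrite fZ //; exact/qZ.
Qed.

Lemma descend_subproof (f : rel_maps ZD b0) :
  continuous (descend_fun f) /\ forall e, ZE e -> descend_fun f e = b0.
Proof.
split; last by move=> e Ze; rewrite /descend_fun asboolT.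
apply/continuous_closedP => A clA.
(* The second piece is there because [q] may miss points of [ZE]: for [n = 0] the cube is one
   unmarked point and the pole has no preimage. *)
have -> : descend_fun f @^-1` A =
    q @` (proj1_sig f @^-1` A) `|` (ZE `&` [set _ | A b0]).
  apply/seteqP; split => e /=.
  - rewrite {1}/descend_fun; case: asboolP => [Ze Ab|Ze Ae]; first by right.
    by left; exists (g e) => //; exact: gK.
  - case=> [[d Ad <-]|[Ze Ab]]; first by rewrite descend_funK.
    by rewrite /descend_fun asboolT.
apply: closedU.
  apply: closed_image_compact.
  by apply: (continuous_closedP _).1 clA; case: (proj2_sig f).
have [Ab|nAb] := pselect (A b0).
  by rewrite (_ : [set _ | _] = setT) ?setIT //; apply/seteqP; split.
by rewrite (_ : [set _ | _] = set0) ?setI0; [exact: closed0 | apply/seteqP; split].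
Qed.

Definition descend (f : rel_maps ZD b0) : rel_maps ZE b0 :=
  exist _ _ (descend_subproof f).

Lemma descend_continuous : continuous descend.
Proof.
apply: (@kify_continuous (rel_maps_co ZD b0) (rel_maps_co ZE b0)).
apply: continuous_compact_open => f K O cK oO fKO.
have cqK : compact (q @^-1` K).
  apply: subclosed_compact cD _ => //.
  exact: (continuous_closedP _).1 cq _ (compact_closed hE cK).
have := @open_initial_compact_open D B (rel_maps_type ZD b0)
  (fun f => proj1_sig f) _ _ cqK oO.
rewrite openE => /(_ f)/= h.
have : forall d, (q @^-1` K) d -> O (proj1_sig f d).
  by move=> d Kd; rewrite -descend_funK; exact: fKO.
move/h; apply: filterS => f' f'K e Ke /=; rewrite /descend_fun.
(* Points of [ZE] in [K] may lie outside the image of [q]; every descended map is [b0] there, and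
   [fKO] shows that [b0] is in [O]. *)
case: asboolP => Ze; last by apply: f'K; rewrite /= gK.
by have := fKO e Ke; rewrite /= /descend_fun asboolT.
Qed.

Lemma rel_maps_homeomorphic : homeomorphic (rel_maps ZD b0) (rel_maps ZE b0).
Proof.
exists descend, (precomp cq (fun d => (qZ d).2)); split.
- exact: descend_continuous.
- exact: precomp_continuous.
- by move=> f; apply: rel_maps_eq => d; exact: descend_funK.
- move=> f; apply: rel_maps_eq => e /=; rewrite /descend_fun.
  case: asboolP => Ze; last by rewrite /= gK.
  by case: f => f [cf fZ]; rewrite /= fZ.
Qed.

End RelativeHomeomorphism.

Lemma continuous_matrix (R : realType) (Y : topologicalType) (m p : nat)
    (F : Y -> 'M[R]_(m, p)) :
  (forall i j, continuous (fun y => F y i j)) -> continuous F.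
Proof.
move=> cF y A [Q FQ QA]; apply: (filterS (P := [set y' | forall i j, Q i j (F y' i j)])).
  by move=> y' Qy'; exact: QA.
by apply: filter_forall => i; apply: filter_forall => j; apply: cF; exact: FQ.
Qed.

Section Sphere.
Variables (R : realType) (n : nat).

Definition sphere_pole : set (sphere R n) :=
  [set s | proj1_sig s = sphere_base R n].

Lemma based_map_spaceE (B : topologicalType) (b0 : B) :
  based_map_space R n b0 = rel_maps sphere_pole b0.
Proof. by []. Qed.

Lemma sphere_val_continuous :
  continuous (fun s : sphere R n => proj1_sig s : 'rV[R]_n.+1).
Proof. exact: initial_continuous. Qed.

Lemma sphere_hausdorff : hausdorff_space (sphere R n).
Proof.
apply: hausdorff_injective sphere_val_continuous _ _; last exact: norm_hausdorff.
by move=> [s ps] [t pt] /= st; apply: eq_exist.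
Qed.

Lemma closed_sphere_pole : closed sphere_pole.
Proof.
apply: ((continuous_closedP _).1 sphere_val_continuous [set sphere_base R n]).
exact/accessible_closed_set1/hausdorff_accessible/norm_hausdorff.
Qed.

Local Notation cube := (prism R (fun _ : 'I_n => 1%N)).

(** Clamping makes the map total, so the cube is the continuous image of a compact box of row
    vectors ([compact_cube]). *)
Definition cube_point_fun (v : 'rV[R]_n) (k : 'I_n) (j : nat) : R :=
  match j with 0 => 0 | 1 => unit_clamp (v ord0 k) | _ => 1 end.

Lemma cube_point_subproof v : is_prism (fun _ => 1%N) (cube_point_fun v).
Proof.
move=> k; split => //; last by case=> [|[]].
have /andP[c0 c1] := unit_clamp_itv (v ord0 k).
by move=> [|[|i]] [|[|j]] //= _; exact: ler01.
Qed.

Definition cube_point v : cube := exist _ _ (cube_point_subproof v).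

Lemma cube_point_continuous : continuous cube_point.
Proof.
apply: prism_continuous => k [|[|j]]; [exact: cst_continuous | | exact: cst_continuous].
move=> v; apply: (@continuous_comp _ _ _ (fun v : 'rV[R]_n => v ord0 k) (@unit_clamp R)).
  exact: coord_continuous.
exact: unit_clamp_continuous.
Qed.

Lemma unit_clamp_id (x : R) : 0 <= x <= 1 -> unit_clamp x = x.
Proof.
by move=> /andP[x0 x1]; rewrite /unit_clamp (min_idPr x1) (max_idPr x0).
Qed.

Lemma cube_pointK (t : cube) : cube_point (\row_k coord t k 1%N) = t.
Proof.
apply: prism_eq => k [//|[|//]] _; rewrite /coord /= mxE unit_clamp_id //.
by rewrite coord_ge0 coord_le1.
Qed.

Lemma compact_cube : compact [set: cube].
Proof.
rewrite (_ : setT = cube_point @` [set v : 'rV[R]_n | forall k, `[0, 1]%classic (v ord0 k)]).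
  apply: continuous_compact; last first.
    by apply: (@rV_compact R n (fun=> `[0, 1]%classic)) => _; exact: segment_compact.
  exact/continuous_subspaceT/cube_point_continuous.
apply/seteqP; split => // t _; exists (\row_k coord t k 1%N); last exact: cube_pointK.
by move=> k; rewrite /= in_itv /= mxE coord_ge0 coord_le1.
Qed.

(** Two norms are at work: the Euclidean one, for the equation of the sphere, and the sup norm,
    whose unit ball is a cube. *)
Definition sqnorm (y : 'rV[R]_n) : R := \sum_k y ord0 k ^+ 2.

Lemma coord_le_norm (y : 'rV[R]_n) k : `|y ord0 k| <= `|y|.
Proof.
rewrite [leRHS]/Num.Def.normr /= mx_normrE.
exact: (le_bigmax _ (fun ij : 'I_1 * 'I_n => `|y ij.1 ij.2|) (ord0, k)).
Qed.

Lemma norm_attained (y : 'rV[R]_n) : `|y| != 0 -> exists k, `|y| = `|y ord0 k|.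
Proof. by move=> /mx_norm_neq0[[i k] /= yk]; exists k; rewrite (ord1 i) in yk; exact: yk. Qed.

Lemma sqr_norm_le_sqnorm (y : 'rV[R]_n) : `|y| ^+ 2 <= sqnorm y.
Proof.
have [->|/norm_attained[k ->]] := eqVneq `|y| 0.
  by rewrite expr0n /=; apply: sumr_ge0 => k _; exact: sqr_ge0.
rewrite /sqnorm (bigD1 k) //= real_normK ?num_real // lerDl.
by apply: sumr_ge0 => j _; exact: sqr_ge0.
Qed.

Lemma sqnormZ (a : R) y : sqnorm (a *: y) = a ^+ 2 * sqnorm y.
Proof. by rewrite /sqnorm mulr_sumr; apply: eq_bigr => k _; rewrite mxE exprMn. Qed.

Definition stereo_den (y : 'rV[R]_n) : R := sqnorm y + (1 - `|y|) ^+ 2.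

(** The sup norm [N] of [y] is bounded by its Euclidean norm, so the denominator is at least
    [N^2 + (1 - N)^2], which never vanishes. *)
Lemma stereo_den_gt0 y : 0 < stereo_den y.
Proof. by rewrite /stereo_den; have := sqr_norm_le_sqnorm y; nra. Qed.

(* Inverse stereographic projection of y / (1 - |y|), with denominators cleared
   so that it extends to the whole boundary of the unit ball of the sup norm. *)
Definition stereo_fun (y : 'rV[R]_n) : 'rV[R]_n.+1 :=
  \row_j (if unlift ord0 j is Some k
          then 2 * (1 - `|y|) * y ord0 k / stereo_den y
          else (sqnorm y - (1 - `|y|) ^+ 2) / stereo_den y).

Lemma stereo_fun0 y :
  stereo_fun y ord0 ord0 = (sqnorm y - (1 - `|y|) ^+ 2) / stereo_den y.
Proof. by rewrite mxE unlift_none. Qed.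

Lemma stereo_funS y k :
  stereo_fun y ord0 (lift ord0 k) = 2 * (1 - `|y|) * y ord0 k / stereo_den y.
Proof. by rewrite mxE liftK. Qed.

Lemma stereo_subproof y : sphere_pred (stereo_fun y).
Proof.
rewrite /sphere_pred big_ord_recl stereo_fun0.
under eq_bigr => k _ do rewrite stereo_funS.
have D0 := lt0r_neq0 (stereo_den_gt0 y).
rewrite (eq_bigr (fun k => (2 * (1 - `|y|) / stereo_den y) ^+ 2 * y ord0 k ^+ 2)); last first.
  by move=> k _; field.
rewrite -mulr_sumr -/(sqnorm y); apply/eqP.
by move: D0; rewrite /stereo_den => D0; field.
Qed.

Definition stereo y : sphere R n :=
  exist (fun x => is_true (sphere_pred x)) _ (stereo_subproof y).

Lemma stereo_continuous : continuous stereo.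
Proof.
have cN : continuous (fun y : 'rV[R]_n => 1 - `|y|).
  by apply: subr_continuous; [exact: cst_continuous | exact: norm_continuous].
have cE : continuous sqnorm.
  apply: sumr_continuous => k y; apply: (@continuous_comp _ _ _
    (fun y : 'rV[R]_n => y ord0 k) (fun x : R => x ^+ 2)).
    exact: coord_continuous.
  exact: exprn_continuous.
have cN2 : continuous (fun y : 'rV[R]_n => (1 - `|y|) ^+ 2).
  exact: (mulr_continuous cN cN).
have cD : continuous (fun y => (stereo_den y)^-1).
  move=> y; have D0 := lt0r_neq0 (stereo_den_gt0 y).
  exact: (cvgV D0 (addr_continuous cE cN2 (x := y))).
apply: continuous_comp_initial; apply: continuous_matrix => i j.
rewrite (_ : (fun _ => _) = fun y => stereo_fun y i j) //.
rewrite (ord1 i); case: (unliftP ord0 j) => [k|] ->.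
- rewrite (_ : (fun _ => _) = fun y : 'rV[R]_n =>
    2 * (1 - `|y|) * y ord0 k * (stereo_den y)^-1); last first.
    by apply/funext => y; rewrite stereo_funS.
  apply: mulr_continuous => //; apply: mulr_continuous; last exact: coord_continuous.
  by apply: mulr_continuous => //; exact: cst_continuous.
- rewrite (_ : (fun _ => _) = fun y : 'rV[R]_n =>
    (sqnorm y - (1 - `|y|) ^+ 2) * (stereo_den y)^-1); last first.
    by apply/funext => y; rewrite stereo_fun0.
  by apply: mulr_continuous => //; exact: subr_continuous.
Qed.

Lemma sphere_eqP (s : sphere R n) :
  proj1_sig s ord0 ord0 ^+ 2 +
  \sum_(k < n) proj1_sig s ord0 (lift ord0 k) ^+ 2 = 1.
Proof. by case: s => s /= /eqP <-; rewrite big_ord_recl. Qed.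

Lemma sphere_poleE (s : sphere R n) :
  sphere_pole s <-> proj1_sig s ord0 ord0 = 1.
Proof.
split=> [->|s0]; first by rewrite mxE eqxx.
have := sphere_eqP s; rewrite s0 expr1n => /eqP.
rewrite -subr_eq0 addrAC subrr add0r => /eqP /psumr_eq0P s0'.
apply/rowP => j; rewrite mxE; case: (unliftP ord0 j) => [k|] ->.
  rewrite -(inj_eq val_inj) /=.
  by apply/eqP; rewrite -sqrf_eq0; apply/eqP/s0' => // l _; exact: sqr_ge0.
by rewrite eqxx s0.
Qed.

(** Numerator and denominator of the coordinate at index [0] differ by [2 (1 - N)^2], with [N] the
    sup norm of [y]. *)
Lemma stereo_pole y : sphere_pole (stereo y) <-> `|y| = 1.
Proof.
rewrite sphere_poleE /= stereo_fun0; have D0 := lt0r_neq0 (stereo_den_gt0 y).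
split=> [/divr1_eq|y1].
  rewrite /stereo_den => h; have /eqP : (1 - `|y|) ^+ 2 = 0 by lra.
  by rewrite sqrf_eq0 subr_eq0 => /eqP <-.
by move: D0; rewrite /stereo_den y1 subrr expr0n /= subr0 addr0 => /divff.
Qed.

Definition stereo_proj (s : sphere R n) : 'rV[R]_n :=
  \row_k (proj1_sig s ord0 (lift ord0 k) / (1 - proj1_sig s ord0 ord0)).

(** [z / (1 + |z|)] inverts [y / (1 - |y|)] on the open unit ball. At the pole, division by zero
    makes the value 0. *)
Definition unstereo (s : sphere R n) : 'rV[R]_n :=
  (1 + `|stereo_proj s|)^-1 *: stereo_proj s.

Lemma norm_unstereo s :
  `|unstereo s| = `|stereo_proj s| / (1 + `|stereo_proj s|).
Proof. by rewrite normrZ mulrC ger0_norm // invr_ge0. Qed.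

Lemma norm_unstereo_lt1 s : `|unstereo s| < 1.
Proof.
by rewrite norm_unstereo ltr_pdivrMr ?mul1r ?ltrDr // ltr_pwDl.
Qed.

Lemma stereoK y : `|y| < 1 -> unstereo (stereo y) = y.
Proof.
move=> y1; have D0 := lt0r_neq0 (stereo_den_gt0 y).
have N0 : 1 - `|y| != 0 by lra.
have pE : stereo_proj (stereo y) = (1 - `|y|)^-1 *: y.
  apply/rowP => k; rewrite mxE /= stereo_funS stereo_fun0 mxE.
  have -> : 1 - (sqnorm y - (1 - `|y|) ^+ 2) / stereo_den y =
            2 * (1 - `|y|) ^+ 2 / stereo_den y.
    by move: D0; rewrite /stereo_den => D0; field.
  by field; rewrite N0 D0.
rewrite /unstereo pE normrZ ger0_norm ?invr_ge0 ?subr_ge0 1?ltW // scalerA.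
rewrite (_ : _ * _ = 1) ?scale1r //; field; rewrite N0 /=.
by rewrite subrK oner_eq0.
Qed.

Lemma unstereoK s : ~ sphere_pole s -> stereo (unstereo s) = s.
Proof.
move=> sP; set w := proj1_sig s ord0 ord0.
have w1 : 1 - w != 0.
  by rewrite subr_eq0; apply/eqP => w1; apply/sP/sphere_poleE.
set z := stereo_proj s.
have z0 : 0 <= `|z| by [].
have z1 : 1 + `|z| != 0 by lra.
(* The equation of the sphere expresses [sqnorm z] through [w] alone; all that remains is rational
   in [w], the sup norm of [z] and the coordinates. *)
have zE : sqnorm z * (1 - w) ^+ 2 = 1 - w ^+ 2.
  have : \sum_(k < n) proj1_sig s ord0 (lift ord0 k) ^+ 2 = 1 - w ^+ 2.
    by have := sphere_eqP s; rewrite -/w; lra.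
  move=> <-; rewrite /sqnorm mulr_suml.
  by apply: eq_bigr => k _; rewrite mxE -/w -exprMn divfK.
have zE' : sqnorm z = (1 + w) / (1 - w).
  by apply: (mulIf (expf_neq0 2 w1)); rewrite zE; field.
have NE : 1 - `|unstereo s| = (1 + `|z|)^-1 by rewrite norm_unstereo -/z; field.
have EE : sqnorm (unstereo s) = (1 + `|z|)^-1 ^+ 2 * sqnorm z by rewrite sqnormZ.
have DE : stereo_den (unstereo s) = (1 + `|z|)^-1 ^+ 2 * 2 / (1 - w).
  by rewrite /stereo_den NE EE zE'; field; rewrite w1 z1.
have st : stereo_fun (unstereo s) = proj1_sig s.
  apply/rowP => j; case: (unliftP ord0 j) => [k|] ->.
  - rewrite stereo_funS NE DE !mxE -/w -/z; field.
    by rewrite w1 z1.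
  - by rewrite stereo_fun0 NE DE EE zE' -/w; field; rewrite w1 z1.
by case: s st {sP w w1 z z0 z1 zE zE' NE EE DE} => s ps st; apply: eq_exist.
Qed.

Definition cube_vector (t : cube) : 'rV[R]_n := \row_k (2 * coord t k 1%N - 1).

Lemma cube_vector_continuous : continuous cube_vector.
Proof.
apply: continuous_matrix => i k.
rewrite (_ : (fun _ => _) = fun t : cube => 2 * coord t k 1%N - 1); last first.
  by apply/funext => t; rewrite mxE.
apply: subr_continuous; last exact: cst_continuous.
by apply: mulr_continuous; [exact: cst_continuous | exact: prism_coord_continuous].
Qed.

Lemma norm_cube_vector_le1 t : `|cube_vector t| <= 1.
Proof.
have [->|/norm_attained[k ->]] := eqVneq `|cube_vector t| 0; first exact: ler01.
rewrite mxE ler_norml; have := coord_ge0 t k 1; have := coord_le1 t k 1 => ? ?.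
by apply/andP; split; lra.
Qed.

(** Only [t_1] is free in each component, and [2 t_1 - 1] has absolute value 1 exactly at the two
    vertices; the sup norm is attained at some component. *)
Lemma markedE (t : cube) : marked t <-> `|cube_vector t| = 1.
Proof.
split=> [[k tk]|t1].
  apply/eqP; rewrite eq_le norm_cube_vector_le1 /=.
  apply: le_trans (coord_le_norm _ k); rewrite mxE.
  by case: (tk 1%N) => ->; rewrite ?mulr0 ?sub0r ?normrN ?normr1 //
    (_ : 2 * 1 - 1 = 1 :> R) ?normr1 //; lra.
have [k] : exists k, `|cube_vector t| = `|cube_vector t ord0 k|.
  by apply: norm_attained; rewrite t1 oner_eq0.
rewrite t1 mxE => /esym/eqP; rewrite eqr_norml ler01 andbT => tk.
exists k => -[|[|j]]; [by left; rewrite coord0 | | by right; rewrite coord1].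
by case/orP: tk => /eqP tk; [right | left]; lra.
Qed.

Definition vector_cube (y : 'rV[R]_n) : cube :=
  cube_point (\row_k ((y ord0 k + 1) / 2)).

Lemma cube_vectorK t : vector_cube (cube_vector t) = t.
Proof.
rewrite -[RHS]cube_pointK /vector_cube; congr cube_point.
by apply/rowP => k; rewrite !mxE; lra.
Qed.

Lemma vector_cubeK y : `|y| < 1 -> cube_vector (vector_cube y) = y.
Proof.
move=> y1; apply/rowP => k; rewrite mxE /coord /= mxE unit_clamp_id; first by lra.
have := le_lt_trans (coord_le_norm y k) y1; rewrite ltr_norml => /andP[? ?].
by apply/andP; split; lra.
Qed.

Lemma cube_loops_homeomorphic (B : topologicalType) (b0 : B) :
  homeomorphic (rel_maps (@marked R n (fun _ => 1%N)) b0) (based_map_space R n b0).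
Proof.
rewrite based_map_spaceE.
apply: (@rel_maps_homeomorphic _ _ B _ _ b0 (stereo \o cube_vector)
  (vector_cube \o unstereo)).
- exact: compact_cube.
- exact: sphere_hausdorff.
- exact: closed_sphere_pole.
- move=> t; apply: continuous_comp; first exact: cube_vector_continuous.
  exact: stereo_continuous.
- by move=> t; rewrite stereo_pole markedE.
- move=> t tm; rewrite /= stereoK ?cube_vectorK // lt_neqAle norm_cube_vector_le1 andbT.
  by apply/eqP => t1; apply/tm/markedE.
- by move=> s sP; rewrite /= vector_cubeK ?unstereoK //; exact: norm_unstereo_lt1.
Qed.

End Sphere.

(* Every n-fold loop space Top_*(S^n, B) is (homeomorphic to) the value
   X(1,...,1) of a homotopy (Mon,...,Mon)-algebra X : Delta^n -> Top. *)
Theorem theorem4p2p1 (R : realType) (n : nat) (B : topologicalType) (b0 : B) :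
  CGH B ->
  exists (X : dobj n -> topologicalType)
         (Xmap : forall P Q : dobj n, dhom P Q -> X P -> X Q)
         (xi : forall (i : 'I_n) (P Q S : dobj n), X P -> kify (X Q * X S)%type),
    homotopy_mon_algebra R Xmap xi /\
    homeomorphic (X (fun _ => 1%N)) (based_map_space R n b0).

Proof.
move=> [hB _]; exists (loops R b0), (@loops_map R n B b0), (@loops_split R n B b0).
by split; [exact: loops_algebra | exact: cube_loops_homeomorphic].
Qed.
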